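(* Let $p,q\ge 1$ and let $\bm{x}^e=\mathbf{F}^e/W^e:[0,1]^2\to\mathbb{R}^3$ be a rational Bézier element of bi-degree $(p,q)$ with Jacobian matrix $\bm{\mathcal{J}}^e(\xi,\eta)=[\bm{x}^e_\xi\ \ \bm{x}^e_\eta]\in\mathbb{R}^{3\times 2}$. Then there exist coefficients $D^e_{rs}\in\mathbb{R}$ ($0\le r\le 8p-2$, $0\le s\le 8q-2$), depending only on the control points and weights associated with the element (that is, only on the Bernstein coefficients of $\mathbf{F}^e$ and $W^e$), such that for all $(\xi,\eta)\in[0,1]^2$ $$\det\!\left((\bm{\mathcal{J}}^e)^\top \bm{\mathcal{J}}^e\right)(\xi,\eta)=\frac{1}{(W^e(\xi,\eta))^{8}}\sum_{r=0}^{8p-2}\sum_{s=0}^{8q-2}D^e_{rs}\,B_r^{8p-2}(\xi)\,B_s^{8q-2}(\eta).$$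
   Context: $B_i^n(t)=\binom{n}{i}t^i(1-t)^{n-i}$, $0\le i\le n$, denote the Bernstein polynomials of degree $n$. A rational Bézier element of bi-degree $(p,q)$ is a map $\bm{x}^e=\mathbf{F}^e/W^e$ on $[0,1]^2$, where $\mathbf{F}^e(\xi,\eta)=\sum_{i=0}^p\sum_{j=0}^q \mathbf{F}_{ij}B_i^p(\xi)B_j^q(\eta)$ with $\mathbf{F}_{ij}\in\mathbb{R}^3$ (the weighted control points) and $W^e(\xi,\eta)=\sum_{k=0}^p\sum_{\ell=0}^q W_{k\ell}B_k^p(\xi)B_\ell^q(\eta)$ with $W_{k\ell}\in\mathbb{R}$. The weights are positive, so that $W^e>0$ on $[0,1]^2$. Subscripts $\xi,\eta$ on $\bm{x}^e$ denote partial derivatives. *)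

(* Defs.v *)
From HB Require Import structures.
From mathcomp Require Import all_boot all_order all_algebra.
From mathcomp Require Import all_classical all_reals all_analysis.

Set Implicit Arguments.
Unset Strict Implicit.
Unset Printing Implicit Defensive.

Import Order.TTheory GRing.Theory Num.Theory.
Import numFieldNormedType.Exports.

Local Open Scope ring_scope.

Definition bernstein (R : realType) (n i : nat) (t : R) : R :=
  'C(n, i)%:R * t ^+ i * (1 - t) ^+ (n - i).

Definition bezier_num (R : realType) (p q : nat)
    (F : 'I_p.+1 -> 'I_q.+1 -> 'cV[R]_3) (xi eta : R) : 'cV[R]_3 :=
  \sum_(i < p.+1) \sum_(j < q.+1)
    (bernstein p i xi * bernstein q j eta) *: F i j.

Definition bezier_weight (R : realType) (p q : nat)
    (W : 'I_p.+1 -> 'I_q.+1 -> R) (xi eta : R) : R :=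
  \sum_(k < p.+1) \sum_(l < q.+1)
    W k l * bernstein p k xi * bernstein q l eta.

(* The quotient formula is taken on all of R^2, with x / 0 = 0; for positive
   weights the denominator is positive on a neighbourhood of [0,1]^2. *)
Definition rational_bezier (R : realType) (p q : nat)
    (F : 'I_p.+1 -> 'I_q.+1 -> 'cV[R]_3) (W : 'I_p.+1 -> 'I_q.+1 -> R)
    (xi eta : R) : 'cV[R]_3 :=
  (bezier_weight W xi eta)^-1 *: bezier_num F xi eta.

(* Two-sided partial derivatives of the extended map: on the boundary of
   [0,1]^2 they agree with the one-sided derivatives of the element. *)
Definition jacobian_mx (R : realType) (x : R -> R -> 'cV[R]_3) (xi eta : R) :
    'M[R]_(3, 2) :=
  row_mx (derive1 (fun s : R => x s eta) xi) (derive1 (fun t : R => x xi t) eta).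

(* Main.v *)
Require Import Defs.
From HB Require Import structures.
From mathcomp Require Import all_boot all_order all_algebra.
From mathcomp Require Import all_classical all_reals all_analysis.
From mathcomp Require Import ring zify.

Set Implicit Arguments.
Unset Strict Implicit.
Unset Printing Implicit Defensive.

Import Order.TTheory GRing.Theory Num.Theory.
Import numFieldNormedType.Exports.

Local Open Scope ring_scope.

(** By the quotient rule, the two columns of the Jacobian matrix are
    [u / W^2] and [v / W^2] with [u = F_xi W - F W_xi] and
    [v = F_eta W - F W_eta].  The Gram determinant of two columns is
    [|u|^2 |v|^2 - (u . v)^2], homogeneous of degree 4 in the pair of columns,
    so it equals [(|u|^2 |v|^2 - (u . v)^2) / (W^2)^4], and only the numerator
    has to be expanded in Bernstein polynomials.

    Bernstein expansions are stable under products, the bidegrees adding up,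
    and a partial derivative lowers the degree in its variable by one.  The
    reason in both cases is that the Bernstein polynomials of degree [n] are,
    up to nonzero constants, the forms [t^a (1 - t)^b] with [a + b = n]: such
    forms multiply to forms of the same shape, and differentiating one gives
    two forms of degree [n - 1] ([bernstein_spanM], [bernstein_span_derive1]).
    Hence the entries of [u] have bidegree [(2p - 1, 2q)] and those of [v]
    bidegree [(2p, 2q - 1)].  Both terms of the numerator contain two factors
    from [u] and two from [v], so both have bidegree exactly
    [(2 (2p - 1) + 2 (2p), 2 (2q) + 2 (2q - 1)) = (8p - 2, 8q - 2)]
    ([bernstein_span_gram]), and no degree elevation is involved.

    Positivity of the weights serves only to make [W] nonzero on the unit
    square, so that the quotient rule applies there.  The numerator is defined
    from [F] and [W] alone; picking one expansion of it for each pair [(F, W)]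
    gives the coefficients as a function of the control points and weights. *)

(** * Bivariate Bernstein expansions *)

(** The weight function of an arbitrary array of coefficients is the general
    Bernstein form of bidegree [(m, n)]; here it is used with coefficients of
    any sign. *)
Definition bernstein_span (R : realType) (m n : nat) (f : R -> R -> R) :=
  exists c : 'I_m.+1 -> 'I_n.+1 -> R, forall x y, f x y = bezier_weight c x y.

Section BernsteinSpan.
Variable R : realType.
Implicit Types (m n a b c d : nat) (f g : R -> R -> R).

Lemma bezier_weight_in_span m n (c : 'I_m.+1 -> 'I_n.+1 -> R) :
  bernstein_span m n (bezier_weight c).
Proof. by exists c. Qed.

Lemma eq_bernstein_span m n f g :
  (forall x y, f x y = g x y) -> bernstein_span m n f -> bernstein_span m n g.
Proof. by move=> fg [c fc]; exists c => x y; rewrite -fg. Qed.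

Lemma bernstein_span0 m n : bernstein_span m n (fun _ _ : R => 0).
Proof.
exists (fun _ _ => 0) => x y; rewrite /bezier_weight big1 // => i _.
by rewrite big1 // => j _; rewrite !mul0r.
Qed.

Lemma bernstein_spanD m n f g : bernstein_span m n f -> bernstein_span m n g ->
  bernstein_span m n (fun x y => f x y + g x y).
Proof.
move=> [c fc] [d gd]; exists (fun i j => c i j + d i j) => x y.
rewrite fc gd -big_split; apply: eq_bigr => i _; rewrite -big_split.
by apply: eq_bigr => j _; rewrite !mulrDl.
Qed.

Lemma bernstein_spanZ m n (k : R) f : bernstein_span m n f ->
  bernstein_span m n (fun x y => k * f x y).
Proof.
move=> [c fc]; exists (fun i j => k * c i j) => x y.
rewrite fc mulr_sumr; apply: eq_bigr => i _; rewrite mulr_sumr.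
by apply: eq_bigr => j _; rewrite !mulrA.
Qed.

Lemma bernstein_spanB m n f g : bernstein_span m n f -> bernstein_span m n g ->
  bernstein_span m n (fun x y => f x y - g x y).
Proof.
move=> fS gS; apply: eq_bernstein_span (bernstein_spanD fS (bernstein_spanZ (-1) gS)).
by move=> x y; rewrite mulN1r.
Qed.

Lemma bernstein_span_sum m n (I : Type) (s : seq I) (f : I -> R -> R -> R) :
  (forall i, bernstein_span m n (f i)) ->
  bernstein_span m n (fun x y => \sum_(i <- s) f i x y).
Proof.
move=> fS; elim: s => [|i s IHs].
  by apply: eq_bernstein_span (bernstein_span0 m n) => x y; rewrite big_nil.
apply: eq_bernstein_span (bernstein_spanD (fS i) IHs) => x y.
by rewrite big_cons.
Qed.

Lemma bernstein_span_swap m n f :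
  bernstein_span m n f -> bernstein_span n m (fun x y => f y x).
Proof.
move=> [c fc]; exists (fun i j => c j i) => x y.
rewrite fc /bezier_weight exchange_big; apply: eq_bigr => i _.
by apply: eq_bigr => j _; rewrite mulrAC.
Qed.

(** The only Bernstein product involved is the one of indices [(a, c)], scaled
    by the inverse of its two binomial coefficients; this lemma is how every
    other expansion is obtained, without an explicit formula for its
    coefficients. *)
Lemma bernstein_span_monomial m n a b c d : (a + b = m)%N -> (c + d = n)%N ->
  bernstein_span m n
    (fun x y : R => (x ^+ a * (1 - x) ^+ b) * (y ^+ c * (1 - y) ^+ d)).
Proof.
move=> <- <-; have a_lt : (a < (a + b).+1)%N by rewrite ltnS leq_addr.
have c_lt : (c < (c + d).+1)%N by rewrite ltnS leq_addr.
exists (fun i j => ((i == Ordinal a_lt) && (j == Ordinal c_lt))%:R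
   / ('C(a + b, a)%:R * 'C(c + d, c)%:R)) => x y.
rewrite /bezier_weight (bigD1 (Ordinal a_lt)) //= (bigD1 (Ordinal c_lt)) //=.
rewrite big1 ?addr0 => [|j /negPf ->]; last by rewrite andbF !mul0r.
rewrite big1 ?addr0 => [|i /negPf ->]; last first.
  by rewrite big1 // => j _; rewrite !mul0r.
rewrite /bernstein !eqxx !addKn /= mul1r.
have Ca : 'C(a + b, a)%:R != 0 :> R by rewrite pnatr_eq0 -lt0n bin_gt0 leq_addr.
have Cc : 'C(c + d, c)%:R != 0 :> R by rewrite pnatr_eq0 -lt0n bin_gt0 leq_addr.
by field; apply/andP.
Qed.

(** A product of two Bernstein polynomials of degrees [m] and [m'] and indices
    [i] and [k] is a multiple of [x^(i + k) (1 - x)^(m + m' - i - k)]. *)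
Lemma bernstein_spanM m n m' n' f g :
  bernstein_span m n f -> bernstein_span m' n' g ->
  bernstein_span (m + m') (n + n') (fun x y => f x y * g x y).
Proof.
move=> [c fc] [d gd].
have key (i : 'I_m.+1) (j : 'I_n.+1) (k : 'I_m'.+1) (l : 'I_n'.+1) :
  bernstein_span (m + m') (n + n') (fun x y : R =>
    c i j * bernstein m i x * bernstein n j y *
    (d k l * bernstein m' k x * bernstein n' l y)).
  have [im jn] := (leq_ord i, leq_ord j); have [km ln] := (leq_ord k, leq_ord l).
  have Em : (i + k + ((m - i) + (m' - k)) = m + m')%N by lia.
  have En : (j + l + ((n - j) + (n' - l)) = n + n')%N by lia.
  have := bernstein_spanZ
    (c i j * d k l * 'C(m, i)%:R * 'C(n, j)%:R * 'C(m', k)%:R * 'C(n', l)%:R)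
    (bernstein_span_monomial Em En).
  apply: eq_bernstein_span => x y; rewrite /bernstein !exprD; ring.
have S := bernstein_span_sum (index_enum _) (fun i =>
  bernstein_span_sum (index_enum _) (fun j =>
  bernstein_span_sum (index_enum _) (fun k =>
  bernstein_span_sum (index_enum _) (fun l => key i j k l)))).
apply: eq_bernstein_span S => x y; rewrite fc gd mulr_suml.
apply: eq_bigr => i _; rewrite mulr_suml; apply: eq_bigr => j _.
rewrite mulr_sumr; apply: eq_bigr => k _; rewrite mulr_sumr.
by [].
Qed.

(** * Partial derivatives *)

(** The derivative is left in this product-rule form, rather than as a
    difference of two Bernstein polynomials of degree [n - 1], because it
    then needs no convention for out-of-range indices: a summand whose
    truncated exponent is wrong carries a zero factor. *)
Lemma is_derive_bernstein n i (x : R) : is_derive x 1 (bernstein n i)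
  ('C(n, i)%:R * (i%:R * (x ^+ i.-1 * (1 - x) ^+ (n - i)) -
                  (n - i)%:R * (x ^+ i * (1 - x) ^+ (n - i).-1))).
Proof.
set P : {poly R} := 'C(n, i)%:R *: ('X^i * (1 - 'X) ^+ (n - i)).
have -> : bernstein n i = horner P.
  by apply/funext => t; rewrite /bernstein /P !hornerE.
apply: is_derive_eq.
rewrite /P derivZ derivM derivXn deriv_exp derivB derivX derivC.
rewrite !(hornerZ, hornerD, hornerN, hornerM, hornerMn, horner_exp, hornerX,
  hornerC).
rewrite -mulr_natl -[in X in _ + X]mulr_natl; ring.
Qed.

Lemma bernstein_span_is_derive m n f : (0 < m)%N -> bernstein_span m n f ->
  exists2 f', bernstein_span m.-1 n f' &
    forall x y : R, is_derive x 1 (fun s => f s y) (f' x y).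
Proof.
move=> m_gt0 [c fc].
pose dB i (x : R) := 'C(m, i)%:R * (i%:R * (x ^+ i.-1 * (1 - x) ^+ (m - i)) -
                  (m - i)%:R * (x ^+ i * (1 - x) ^+ (m - i).-1)).
exists (fun x y : R => \sum_(i < m.+1) \sum_(j < n.+1)
   (c i j * bernstein n j y) * dB i x).
  apply: bernstein_span_sum => i; apply: bernstein_span_sum => j.
  have [im jn] := (leq_ord i, leq_ord j).
  have En : (j + (n - j) = n)%N by lia.
  (* For i = 0 the exponents of S1, and for i = m those of S2, do not add up
     to m - 1, but these summands vanish. *)
  have S1 : bernstein_span m.-1 n (fun x y : R => i%:R *
      ((x ^+ i.-1 * (1 - x) ^+ (m - i)) * (y ^+ j * (1 - y) ^+ (n - j)))).
    have [i0|i_gt0] := posnP i.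
      by apply: eq_bernstein_span (bernstein_span0 _ _) => x y; rewrite i0 mul0r.
    by apply: bernstein_spanZ; apply: bernstein_span_monomial => //; lia.
  have S2 : bernstein_span m.-1 n (fun x y : R => (m - i)%:R *
      ((x ^+ i * (1 - x) ^+ (m - i).-1) * (y ^+ j * (1 - y) ^+ (n - j)))).
    have [i0|i_gt0] := posnP (m - i).
      by apply: eq_bernstein_span (bernstein_span0 _ _) => x y; rewrite i0 mul0r.
    by apply: bernstein_spanZ; apply: bernstein_span_monomial => //; lia.
  apply: eq_bernstein_span
    (bernstein_spanZ (c i j * 'C(n, j)%:R * 'C(m, i)%:R) (bernstein_spanB S1 S2)).
  move=> x y; rewrite /dB /bernstein; ring.
move=> x y.
have -> : (fun s => f s y) = \sum_(i < m.+1) \sum_(j < n.+1)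
    (c i j * bernstein n j y) \*: (bernstein m i).
  apply/funext => s; rewrite fc fct_sumE; apply: eq_bigr => i _.
  rewrite fct_sumE; apply: eq_bigr => j _.
  by rewrite mulrAC.
apply: is_derive_sum => i; apply: is_derive_sum => j.
by apply: is_deriveZ; apply: is_derive_bernstein.
Qed.


Lemma bernstein_span_derivable1 m n f (x y : R) : (0 < m)%N ->
  bernstein_span m n f -> derivable (fun s => f s y) x 1.
Proof. by move=> m_gt0 /(bernstein_span_is_derive m_gt0)[f' _ /(_ x y)[]]. Qed.

Lemma bernstein_span_derive1 m n f : (0 < m)%N -> bernstein_span m n f ->
  bernstein_span m.-1 n (fun x y => derive1 (fun s => f s y) x).
Proof.
move=> m_gt0 /(bernstein_span_is_derive m_gt0)[f' f'S df].
apply: eq_bernstein_span f'S => x y; rewrite derive1E.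
by have df_xy := df x y; rewrite derive_val.
Qed.

Lemma bernstein_span_derivable2 m n f (x y : R) : (0 < n)%N ->
  bernstein_span m n f -> derivable (fun t => f x t) y 1.
Proof.
move=> n_gt0 /bernstein_span_swap fS.
exact: (@bernstein_span_derivable1 _ _ _ y x n_gt0 fS).
Qed.

Lemma bernstein_span_derive2 m n f : (0 < n)%N -> bernstein_span m n f ->
  bernstein_span m n.-1 (fun x y => derive1 (fun t => f x t) y).
Proof.
move=> n_gt0 /bernstein_span_swap/(bernstein_span_derive1 n_gt0).
by move=> /bernstein_span_swap.
Qed.

(** * Positivity of the weight function *)

Lemma bernstein_ge0 n i (x : R) : 0 <= x <= 1 -> 0 <= bernstein n i x.
Proof.
move=> /andP[x_ge0 x_le1].
by rewrite !mulr_ge0 ?exprn_ge0 ?ler0n ?subr_ge0.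
Qed.

Lemma exists_bernstein_gt0 n (x : R) : 0 <= x <= 1 ->
  exists i : 'I_n.+1, 0 < bernstein n i x.
Proof.
move=> /andP[x_ge0 _]; have [->|x_neq0] := eqVneq x 0.
  by exists ord0; rewrite /bernstein bin0 expr0 subr0 expr1n !mul1r.
exists ord_max; rewrite /bernstein /= binn subnn expr0 mulr1 mul1r.
by rewrite exprn_gt0 // lt0r x_neq0.
Qed.

Lemma bezier_weight_gt0 m n (W : 'I_m.+1 -> 'I_n.+1 -> R) (x y : R) :
  (forall i j, 0 < W i j) -> 0 <= x <= 1 -> 0 <= y <= 1 ->
  0 < bezier_weight W x y.
Proof.
move=> W_gt0 x01 y01.
have [k Bk_gt0] := exists_bernstein_gt0 m x01.
have [l Bl_gt0] := exists_bernstein_gt0 n y01.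
have term_ge0 i j : 0 <= W i j * bernstein m i x * bernstein n j y.
  by apply: mulr_ge0; [apply: mulr_ge0; first exact: ltW|]; exact: bernstein_ge0.
rewrite /bezier_weight (bigD1 k) //= (bigD1 l) //= -addrA ltr_pwDl //.
  by apply: mulr_gt0 => //; apply: mulr_gt0.
by rewrite addr_ge0 ?sumr_ge0 // => i _; rewrite sumr_ge0.
Qed.

(** * Differentiating quotients and vectors *)

Lemma is_derive_quotient (f w : R -> R) (x : R) :
  derivable f x 1 -> derivable w x 1 -> w x != 0 ->
  is_derive x 1 (fun s => (w s)^-1 * f s)
    ((w x) ^- 2 * (derive1 f x * w x - f x * derive1 w x)).
Proof.
move=> df dw w_neq0; rewrite !derive1E.
have dV := derivableV w_neq0 dw.
apply: DeriveDef; first exact: derivableM.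
rewrite (deriveM dV df) (deriveV w_neq0 dw) /GRing.scale /=.
by field.
Qed.

Lemma derive1_col n (v : R -> 'cV[R]_n) (d : 'I_n -> R) (x : R) :
  (forall k, is_derive x 1 (fun s => v s k 0) (d k)) ->
  derive1 v x = \col_k d k.
Proof.
move=> dv; rewrite derive1E derive_mx.
  by apply/matrixP => k j; rewrite !mxE ord1; have dvk := dv k; rewrite derive_val.
by apply/derivable_mxP => k j; rewrite ord1; case: (dv k).
Qed.

(** * Gram determinants *)

Lemma det_mx22 (A : 'M[R]_2) : \det A = A 0 0 * A 1 1 - A 0 1 * A 1 0.
Proof.
rewrite (expand_det_row _ 0) !big_ord_recl big_ord0 /cofactor !det_mx11 !mxE /=.
rewrite addr0 expr0 mul1r expr1 mulN1r mulrN.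
by congr (A _ _ * A _ _ - A _ _ * A _ _); apply: val_inj.
Qed.

Lemma det_gramZ m n (k : R) (A : 'M[R]_(m, n)) :
  \det ((k *: A)^T *m (k *: A)) = k ^+ (2 * n) * \det (A^T *m A).
Proof.
have -> : (k *: A)^T = k *: A^T by apply/matrixP => i j; rewrite !mxE.
by rewrite -scalemxAl -scalemxAr scalerA detZ -expr2 exprM.
Qed.

Lemma det_gram_row_mx n (u v : 'cV[R]_n) :
  \det ((row_mx u v)^T *m row_mx u v) =
  (\sum_k u k 0 ^+ 2) * (\sum_k v k 0 ^+ 2) - (\sum_k u k 0 * v k 0) ^+ 2.
Proof.
pose N := row_mx u v; pose A : 'M[R]_2 := N^T *m N.
have AE i j : A i j = \sum_k N k i * N k j.
  by rewrite mxE; apply: eq_bigr => k _; rewrite mxE.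
have N0 k : N k 0 = u k 0.
  by rewrite -(row_mxEl u v); congr (N k _); apply: val_inj.
have N1 k : N k 1 = v k 0.
  by rewrite -(row_mxEr u v); congr (N k _); apply: val_inj.
rewrite (det_mx22 A) !AE expr2.
by congr (_ * _ - _ * _); apply: eq_bigr => k _; rewrite !(N0, N1) // mulrC.
Qed.

(** The two terms of the determinant have the same bidegree because each is of
    degree 2 in [u] and of degree 2 in [v], even when [u] and [v] have
    different bidegrees. *)
Lemma bernstein_span_gram r a b c d (u v : 'I_r -> R -> R -> R) :
  (forall k, bernstein_span a b (u k)) -> (forall k, bernstein_span c d (v k)) ->
  bernstein_span (a + a + (c + c)) (b + b + (d + d)) (fun x y =>
    (\sum_k u k x y ^+ 2) * (\sum_k v k x y ^+ 2)
    - (\sum_k u k x y * v k x y) ^+ 2).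
Proof.
move=> uS vS.
have dotS m n m' n' (f g : 'I_r -> R -> R -> R) :
    (forall k, bernstein_span m n (f k)) ->
    (forall k, bernstein_span m' n' (g k)) ->
    bernstein_span (m + m') (n + n') (fun x y => \sum_k f k x y * g k x y).
  by move=> fS gS; apply: bernstein_span_sum => k; exact: bernstein_spanM.
apply: bernstein_spanB; first by apply: bernstein_spanM; exact: dotS.
(* Regroup the bidegree as that of the square of [u . v]. *)
rewrite addnACA (addnACA b).
by apply: bernstein_spanM; exact: dotS.
Qed.

End BernsteinSpan.

(** * The Gram determinant of a rational element *)

(** The form [G] is the Gram determinant of the columns cleared of their
    denominator [W^2].  It is a polynomial expression in [F], [W] and their
    derivatives, so its expansion holds everywhere and for weights of any
    sign; only the formula for the determinant needs [W] to be nonzero. *)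
Lemma jacobian_gram_span (R : realType) (p q : nat)
    (F : 'I_p.+1 -> 'I_q.+1 -> 'cV[R]_3) (W : 'I_p.+1 -> 'I_q.+1 -> R) :
  (0 < p)%N -> (0 < q)%N ->
  exists2 G, bernstein_span (8 * p - 2) (8 * q - 2) G &
    forall xi eta, bezier_weight W xi eta != 0 ->
      let J := jacobian_mx (rational_bezier F W) xi eta in
      \det (J^T *m J) = (bezier_weight W xi eta) ^- 8 * G xi eta.
Proof.
move=> p_gt0 q_gt0.
pose f k := bezier_weight (fun i j => F i j k 0); pose w := bezier_weight W.
have fS k : bernstein_span p q (f k) by exact: bezier_weight_in_span.
have wS : bernstein_span p q w by exact: bezier_weight_in_span.
pose u k x y := derive1 (fun s => f k s y) x * w x y
                - f k x y * derive1 (fun s => w s y) x.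
pose v k x y := derive1 (fun t => f k x t) y * w x y
                - f k x y * derive1 (fun t => w x t) y.
have uS k : bernstein_span (p.-1 + p) (q + q) (u k).
  apply: bernstein_spanB; first exact/bernstein_spanM/wS/bernstein_span_derive1.
  by rewrite addnC; exact/bernstein_spanM/bernstein_span_derive1.
have vS k : bernstein_span (p + p) (q.-1 + q) (v k).
  apply: bernstein_spanB; first exact/bernstein_spanM/wS/bernstein_span_derive2.
  by rewrite (addnC q.-1); exact/bernstein_spanM/bernstein_span_derive2.
have -> : (8 * p - 2 = p.-1 + p + (p.-1 + p) + (p + p + (p + p)))%N by lia.
have -> : (8 * q - 2 = q + q + (q + q) + (q.-1 + q + (q.-1 + q)))%N by lia.
eexists; first exact: (bernstein_span_gram uS vS).
move=> x y w_neq0 J.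
have xE k s t : rational_bezier F W s t k 0 = (w s t)^-1 * f k s t.
  rewrite /rational_bezier mxE /bezier_num summxE; congr (_ * _).
  apply: eq_bigr => i _; rewrite summxE; apply: eq_bigr => j _.
  by rewrite mxE mulrC mulrA.
have dxi : derive1 (fun s => rational_bezier F W s y) x =
    (w x y) ^- 2 *: \col_k u k x y.
  have -> : (w x y) ^- 2 *: \col_k u k x y = \col_k (w x y ^- 2 * u k x y).
    by apply/matrixP => k j; rewrite !mxE.
  apply: derive1_col => k; under eq_fun do rewrite xE.
  apply: (@is_derive_quotient _ (fun s => f k s y) (fun s => w s y)) => //.
    exact: (bernstein_span_derivable1 p_gt0 (fS k)).
  exact: (bernstein_span_derivable1 p_gt0 wS).
have deta : derive1 (fun t => rational_bezier F W x t) y =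
    (w x y) ^- 2 *: \col_k v k x y.
  have -> : (w x y) ^- 2 *: \col_k v k x y = \col_k (w x y ^- 2 * v k x y).
    by apply/matrixP => k j; rewrite !mxE.
  apply: derive1_col => k; under eq_fun do rewrite xE.
  apply: (@is_derive_quotient _ (f k x) (w x)) => //.
    exact: (bernstein_span_derivable2 q_gt0 (fS k)).
  exact: (bernstein_span_derivable2 q_gt0 wS).
have JE : J = (w x y) ^- 2 *: row_mx (\col_k u k x y) (\col_k v k x y).
  by rewrite /J /jacobian_mx dxi deta scale_row_mx.
rewrite JE det_gramZ det_gram_row_mx -exprVn -exprM exprVn.
by congr (_ * (_ * _ - _ ^+ 2)); apply: eq_bigr => k _; rewrite !mxE.
Qed.

Theorem theorem3p1 (R : realType) (p q : nat)
    (hp : (1 <= p)%N) (hq : (1 <= q)%N) :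
  exists D : ('I_p.+1 -> 'I_q.+1 -> 'cV[R]_3) -> ('I_p.+1 -> 'I_q.+1 -> R) ->
             'I_(8 * p - 2).+1 -> 'I_(8 * q - 2).+1 -> R,
  forall (F : 'I_p.+1 -> 'I_q.+1 -> 'cV[R]_3) (W : 'I_p.+1 -> 'I_q.+1 -> R),
  (forall k l, 0 < W k l) ->
  forall xi eta : R, 0 <= xi <= 1 -> 0 <= eta <= 1 ->
  let J := jacobian_mx (rational_bezier F W) xi eta in
  \det (J^T *m J) =
    1 / (bezier_weight W xi eta) ^+ 8 *
    \sum_(r < (8 * p - 2).+1) \sum_(s < (8 * q - 2).+1)
      D F W r s * bernstein (8 * p - 2) r xi * bernstein (8 * q - 2) s eta.
Proof.
have coefs (FW : ('I_p.+1 -> 'I_q.+1 -> 'cV[R]_3) * ('I_p.+1 -> 'I_q.+1 -> R)) :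
    exists c : 'I_(8 * p - 2).+1 -> 'I_(8 * q - 2).+1 -> R,
    forall xi eta, bezier_weight FW.2 xi eta != 0 ->
      let J := jacobian_mx (rational_bezier FW.1 FW.2) xi eta in
      \det (J^T *m J) = (bezier_weight FW.2 xi eta) ^- 8 * bezier_weight c xi eta.
  have [G [c Gc] detE] := jacobian_gram_span FW.1 FW.2 hp hq.
  by exists c => xi eta w_neq0 J; rewrite [LHS]detE // Gc.
have [D detE] := choice coefs.
exists (fun F W => D (F, W)) => F W W_gt0 xi eta xi01 eta01 J.
by rewrite div1r [LHS](detE (F, W)) // gt_eqF // bezier_weight_gt0.
Qed.
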